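(* Let $t\ge 1$ be an integer and $r=2t$. Then the vertex covering number of the graph $B_{2t}$ is $$\alpha_0(B_{2t})=\begin{cases}\frac{3}{4}r+\frac{3}{2} & \text{if } t \text{ is odd},\\[1mm] \frac{3}{4}r+1 & \text{if } t \text{ is even}.\end{cases}$$
   Context: For an integer $t\ge 1$, $B_{2t}$ is the simple graph with vertex set $\{v_1,\dots,v_{3t+3}\}$ and edge set $\{\{v_i,v_{i+1}\} : 1\le i\le 3t+2,\ i\ne t+1,\ i\neq 2t+2\}\cup\{\{v_i,v_{i+t+1}\} : 1\le i\le 2t+2\}$ (a grid of unit squares with 2 rows and $t$ columns of squares); $r=2t$ is its number of (bounded) regions. A vertex cover of a graph $G$ is a set of vertices such that every edge is incident with at least one vertex of the set; it is minimal if no proper subset is a vertex cover. The vertex covering number $\alpha_0(G)$ is the smallest number of vertices in any minimal vertex cover of $G$. *)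

(* Defs.v *)
From mathcomp Require Import all_boot.

Set Implicit Arguments.
Unset Strict Implicit.
Unset Printing Implicit Defensive.

Record simple_graph (T : finType) := SimpleGraph {
  edges : {set {set T}};
  edges_card2 : forall e, e \in edges -> #|e| = 2
}.

Definition vertex_cover (T : finType) (G : simple_graph T) (C : {set T}) : bool :=
  [forall e in edges G, [exists x in C, x \in e]].

Definition minimal_vertex_cover (T : finType) (G : simple_graph T)
    (C : {set T}) : bool :=
  minset (vertex_cover G) C.

(* The default value #|T| of the iterated minimum is harmless: every cover has
   at most #|T| vertices, and a minimal one exists (see alpha0_attained). *)
Definition alpha0 (T : finType) (G : simple_graph T) : nat :=
  \big[minn/#|T|]_(C : {set T} | minimal_vertex_cover G C) #|C|.

Lemma alpha0_le (T : finType) (G : simple_graph T) (C : {set T}) :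
  minimal_vertex_cover G C -> alpha0 G <= #|C|.
Proof.
move=> mC; rewrite /alpha0; have := mem_index_enum C.
elim: (index_enum _) => //= D s IHs; rewrite inE big_cons.
case/predU1P => [<- | /IHs leC]; first by rewrite mC geq_minl.
by case: ifP => // _; rewrite (leq_trans (geq_minr _ _)).
Qed.

Lemma alpha0_attained (T : finType) (G : simple_graph T) :
  exists2 C : {set T}, minimal_vertex_cover G C & #|C| = alpha0 G.
Proof.
have covT : vertex_cover G [set: T].
  apply/forall_inP => e /edges_card2 e2.
  have /card_gt0P [x xe] : 0 < #|e| by rewrite e2.
  by apply/exists_inP; exists x.
have [C0 mC0 _] := minset_exists covT.
rewrite -/(minimal_vertex_cover G C0) in mC0.
case: (arg_minnP (fun C : {set T} => #|C|) mC0) => C mC minC.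
exists C => //; apply/eqP; rewrite eqn_leq alpha0_le // andbT.
rewrite /alpha0; elim/big_ind: _ => [|m n Cm Cn|D /minC //].
  exact: max_card.
by rewrite leq_min Cm.
Qed.

(* The ordinal x stands for the vertex v_(x + 1). *)
Definition grid2_index (t : nat) (x : 'I_(3 * t + 3)) : nat := x.+1.

(* {v_i, v_j} is an edge in the orientation i < j. *)
Definition grid2_edge (t i j : nat) : bool :=
  [&& 1 <= i <= 3 * t + 2, i != t + 1, i != 2 * t + 2 & j == i + 1]
  || ((1 <= i <= 2 * t + 2) && (j == i + t + 1)).

Definition grid2_edges (t : nat) : {set {set 'I_(3 * t + 3)}} :=
  [set e | [exists x, exists y,
              grid2_edge t (grid2_index x) (grid2_index y)
              && (e == [set x; y])]].

Lemma grid2_edges_card2 (t : nat) (e : {set 'I_(3 * t + 3)}) :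
  e \in grid2_edges t -> #|e| = 2.
Proof.
rewrite inE => /existsP [x /existsP [y /andP [h /eqP ->]]].
rewrite cards2; have [xy|//] := eqVneq x y; move: h; rewrite xy /grid2_edge.
by case/orP => [/and4P [_ _ _]|/andP [_]];
  rewrite -?addnA addn1 ?addnS ltn_eqF // ltnS leq_addr.
Qed.

Definition B2 (t : nat) : simple_graph 'I_(3 * t + 3) :=
  SimpleGraph (@grid2_edges_card2 t).

(* Main.v *)
Require Import Defs.
From mathcomp Require Import all_boot all_order all_algebra.
From mathcomp Require Import zify ring.
Import Order.TTheory GRing.Theory Num.Theory.
Local Open Scope ring_scope.

(** The graph [B2 t] is the 3 x (t + 1) grid, which has a Hamiltonian path: the
    boustrophedon walk through its rows. Pairing consecutive vertices of the
    walk gives a matching with [(3 t + 3) / 2] edges, so every cover has at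
    least that many vertices; every edge of the grid joins positions of opposite
    parity in the walk, so the vertices at odd positions are a cover of that
    size. *)

Section VertexCovers.

Local Open Scope nat_scope.

Lemma alpha0_le_cover (T : finType) (G : simple_graph T) (C : {set T}) :
  vertex_cover G C -> alpha0 G <= #|C|.
Proof.
move=> covC; have [D minD sDC] := minset_exists covC.
by apply: leq_trans (subset_leq_card sDC); apply: alpha0_le.
Qed.

Lemma vertex_cover_B2P (t : nat) (C : {set 'I_(3 * t + 3)}) :
  reflect (forall x y, grid2_edge t (grid2_index x) (grid2_index y) ->
             (x \in C) || (y \in C))
          (vertex_cover (B2 t) C).
Proof.
apply: (iffP forall_inP) => [covC x y exy | covC e].
  have /covC/exists_inP [z zC] : [set x; y] \in edges (B2 t).
    by rewrite inE; apply/existsP; exists x; apply/existsP; exists y; rewrite exy /=.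
  by rewrite !inE => /orP [] /eqP <-; rewrite zC ?orbT.
rewrite inE => /existsP [x /existsP [y /andP [/covC xyC /eqP ->]]].
by apply/exists_inP; case/orP: xyC => ?; [exists x | exists y];
  rewrite // !inE eqxx ?orbT.
Qed.

(* An involution of [0, 3 t + 3), so it gives both the vertex at a given position
   of the walk and the position of a given vertex. *)
Definition snake (t k : nat) : nat :=
  if t < k < 2 * t + 2 then 3 * t + 2 - k else k.

Lemma snake_lt (t k : nat) : k < 3 * t + 3 -> snake t k < 3 * t + 3.
Proof. by rewrite /snake; case: ifP; lia. Qed.

Lemma snakeK (t : nat) : involutive (snake t).
Proof. by move=> k; rewrite /snake; do !case: ifP; lia. Qed.

(** The middle row is walked backwards, so its edges are oriented against the walk; hence the
    disjunction. *)
Lemma snake_step (t k : nat) : k.+1 < 3 * t + 3 ->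
  grid2_edge t (snake t k).+1 (snake t k.+1).+1
  || grid2_edge t (snake t k.+1).+1 (snake t k).+1.
Proof. by rewrite /grid2_edge /snake; do 2!case: ifP; lia. Qed.

(** Neighbours in a row are consecutive on the walk. Column [c], counted from 0, has positions [c],
    [2 * t + 1 - c] and [2 * t + 2 + c], so vertical neighbours have an odd sum of positions. *)
Lemma grid2_edge_odd (t i j : nat) :
  grid2_edge t i.+1 j.+1 -> odd (snake t i) || odd (snake t j).
Proof. by rewrite /grid2_edge /snake; do 2!case: ifP; lia. Qed.

Definition snake_ord (t : nat) (k : 'I_(3 * t + 3)) : 'I_(3 * t + 3) :=
  Ordinal (snake_lt t k (ltn_ord k)).

Lemma snake_ord_inj (t : nat) : injective (snake_ord t).
Proof.
by move=> i j /(congr1 val) /= /(can_inj (snakeK t)) /val_inj.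
Qed.

Lemma alpha0_B2 (t : nat) : alpha0 (B2 t) = (3 * t + 3)./2.
Proof.
set m := (3 * t + 3)./2.
have lt0 (i : 'I_m) : i.*2 < 3 * t + 3 by have := ltn_ord i; rewrite /m; lia.
have lt1 (i : 'I_m) : i.*2.+1 < 3 * t + 3 by have := ltn_ord i; rewrite /m; lia.
(* The ends of the [i]-th matching edge. For even [t] the last position of the walk stays
   unmatched. *)
pose v0 i := snake_ord t (Ordinal (lt0 i)).
pose v1 i := snake_ord t (Ordinal (lt1 i)).
apply/eqP; rewrite eqn_leq; apply/andP; split.
  pose C := [set x : 'I_(3 * t + 3) | odd (snake t x)].
  have covC : vertex_cover (B2 t) C.
    by apply/vertex_cover_B2P => x y /grid2_edge_odd; rewrite !inE.
  apply: leq_trans (alpha0_le_cover _ _ _ covC) _.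
  have sC : C \subset v1 @: setT.
    apply/subsetP => x; rewrite inE => oddx.
    have ltx : (snake t x)./2 < m.
      by have := snake_lt t x (ltn_ord x); rewrite /m; lia.
    apply/imsetP; exists (Ordinal ltx) => //; apply: val_inj => /=.
    have -> : ((snake t x)./2).*2.+1 = snake t x by lia.
    by rewrite snakeK.
  apply: leq_trans (subset_leq_card sC) _.
  by apply: leq_trans (leq_imset_card _ _) _; rewrite cardsT card_ord.
have [C /minsetp/vertex_cover_B2P covC <-] := alpha0_attained (B2 t).
(* [f] picks from each matching edge an end in [C]; it is injective because position [i.*2] or
   [i.*2.+1] determines [i]. *)
pose f i := if v0 i \in C then v0 i else v1 i.
have fC i : f i \in C.
  rewrite /f; case: ifPn => // /negPf v0C.
  have /orP [] := snake_step t i.*2 (lt1 i).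
    by move/(covC (v0 i) (v1 i)); rewrite v0C.
  by move/(covC (v1 i) (v0 i)); rewrite v0C orbF.
have f_inj : injective f.
  move=> i j; rewrite /f; do 2 case: ifP => _;
    by move/snake_ord_inj/(congr1 val) => /= eij; apply: val_inj => /=; lia.
rewrite -[m]card_ord -cardsT -(card_imset _ f_inj); apply: subset_leq_card.
by apply/subsetP => x /imsetP [i _ ->].
Qed.

End VertexCovers.

Theorem proposition3p2 (t r : nat) (ht : (1 <= t)%N) (hr : r = (2 * t)%N) :
  (alpha0 (B2 t))%:R =
    (if odd t then 3 / 4 * r%:R + 3 / 2 else 3 / 4 * r%:R + 1) :> rat.
Proof.
(* Splitting [t] by parity makes the rounded half linear in [h], which leaves a field identity. *)
rewrite alpha0_B2 hr; have := odd_double_half t.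
case: (odd t); move: t./2 => h <-; rewrite ?add1n ?add0n.
  have -> : ((3 * h.*2.+1 + 3)./2 = 3 * h + 3)%N by lia.
  by rewrite -mul2n; field.
have -> : ((3 * h.*2 + 3)./2 = 3 * h + 1)%N by lia.
by rewrite -mul2n; field.
Qed.
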